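(* Let $N\ge1$, let $x_j=\cos\left(\frac{(2j+1)\pi}{2(N+1)}\right)$ for $j=0,\ldots,N$, and let $s_i=[x_i,x_{i-1}]$ for $i=1,\ldots,N$. Let $D_N\in\mathbb R^{N\times N}$ be defined by $[D_N]_{ik}=\int_{s_i}T_k'(x)\,dx$, $i,k=1,\ldots,N$. Let $S_N\in\mathbb R^{N\times N}$ be defined by \[ [S_N]_{ik}=\sin\left(\frac{ik\pi}{N+1}\right),\quad i,k=1,\ldots,N, \] and let \[ \Sigma_N=\operatorname{diag}\left(2\sin\left(\frac{k\pi}{2(N+1)}\right)\right)_{k=1}^N. \] Then \[ D_N=S_N\Sigma_N, \] and consequently \[ D_N^\top D_N=\frac{N+1}{2}\Sigma_N^2 . \]
   Context: $T_k$ is the Chebyshev polynomial of the first kind of degree $k$, $T_k(\cos\theta)=\cos(k\theta)$. *)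

(* Defs.v *)
From mathcomp Require Import all_boot all_order all_algebra.
From mathcomp Require Import all_classical all_reals all_analysis.
From mathcomp Require Import ring.

Set Implicit Arguments.
Unset Strict Implicit.
Unset Printing Implicit Defensive.

Import Order.TTheory GRing.Theory Num.Theory.
Import numFieldNormedType.Exports.

Local Open Scope classical_set_scope.
Local Open Scope ring_scope.

Definition is_chebyshev (R : realType) (k : nat) (p : {poly R}) : Prop :=
  size p = k.+1 /\ forall theta : R, p.[cos theta] = cos (k%:R * theta).

Definition cheb_node (R : realType) (N j : nat) : R :=
  cos ((2 * j + 1)%:R * pi / (2 * (N + 1))%:R).

(* The nodes decrease with j, hence the order of the endpoints. *)
Definition cheb_segment (R : realType) (N i : nat) : set R :=
  `[cheb_node R N i, cheb_node R N i.-1].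

(* Ordinals start at 0: the entry at (i, k) below is the one that has indices
   (i + 1, k + 1) in the 1-based numbering of the rows and columns. *)
Definition cheb_D (R : realType) (T : nat -> {poly R}) (N : nat) : 'M[R]_N :=
  \matrix_(i < N, k < N)
    \int[lebesgue_measure]_(x in cheb_segment N i.+1) (T k.+1)^`().[x].

Definition cheb_S (R : realType) (N : nat) : 'M[R]_N :=
  \matrix_(i < N, k < N) sin ((i.+1 * k.+1)%:R * pi / (N + 1)%:R).

Definition cheb_Sigma (R : realType) (N : nat) : 'M[R]_N :=
  diag_mx (\row_(k < N) (2 * sin (k.+1%:R * pi / (2 * (N + 1))%:R))).

Lemma is_chebyshev0 (R : realType) : is_chebyshev 0 (1 : {poly R}).
Proof. by split=> [|t]; rewrite ?size_poly1// hornerC mul0r cos0. Qed.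

Lemma is_chebyshev1 (R : realType) : is_chebyshev 1 ('X : {poly R}).
Proof. by split=> [|t]; rewrite ?size_polyX// hornerX mul1r. Qed.

Lemma is_chebyshevSS (R : realType) (k : nat) (p q : {poly R}) :
  is_chebyshev k p -> is_chebyshev k.+1 q ->
  is_chebyshev k.+2 (2 *: (q * 'X) - p).
Proof.
move=> [sp hp] [sq hq]; split=> [|t].
  have q0 : q != 0 by rewrite -size_poly_eq0 sq.
  have s2 : size (2 *: (q * 'X)) = k.+3.
    by rewrite size_scale ?pnatr_eq0// size_mulX// sq.
  by rewrite size_polyDl// size_polyN s2 sp.
rewrite hornerD hornerN hornerZ hornerMX hp hq.
have -> : k%:R * t = k.+1%:R * t - t by rewrite -[k.+1]addn1 natrD; ring.
have -> : k.+2%:R * t = k.+1%:R * t + t by rewrite -[k.+2]addn1 natrD; ring.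
by rewrite cosB cosD; ring.
Qed.

Lemma is_chebyshev_exists (R : realType) :
  exists T : nat -> {poly R}, forall k, is_chebyshev k (T k).
Proof.
suff h k : exists p : {poly R}, is_chebyshev k p.
  by exists (fun k => projT1 (cid (h k))) => k; case: cid.
suff [p [q [hp _]]] : exists p q : {poly R},
    is_chebyshev k p /\ is_chebyshev k.+1 q by exists p.
elim: k => [|k [p [q [hp hq]]]].
  by exists 1, 'X; split; [exact: is_chebyshev0|exact: is_chebyshev1].
by exists q, (2 *: (q * 'X) - p); split=> //; exact: is_chebyshevSS.
Qed.

(* Main.v *)
(** The fundamental theorem of calculus and T_k (cos t) = cos (k t) turn the
    entry (i, k) of D_N into a difference of two cosines, which the
    sum-to-product formula factors. The columns of S_N are orthogonal because
    a product of two sines is half a difference of cosines of frequencies k - l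
    and k + l, and over i = 0, ..., N the sum of cos (i m pi / (N + 1)) depends
    only on the parity of m when 0 < m < 2 (N + 1). *)

Require Import Defs.
From mathcomp Require Import all_boot all_order all_algebra.
From mathcomp Require Import all_classical all_reals all_analysis.
From mathcomp Require Import ring zify.
Import Order.TTheory GRing.Theory Num.Theory.
Import numFieldNormedType.Exports.
Local Open Scope ring_scope.

Lemma Rintegral_deriv_poly (R : realType) (p : {poly R}) (a b : R) : a < b ->
  \int[lebesgue_measure]_(x in `[a, b]%classic) p^`().[x] = p.[b] - p.[a].
Proof.
move=> ab; rewrite /Rintegral (@continuous_FTC2 _ (horner p^`()) (horner p))//.
- by apply: continuous_subspaceT => x; exact: continuous_horner.
- by split=> [x _||]; [exact: derivable_horner|
    apply: cvg_at_right_filter; exact: continuous_horner|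
    apply: cvg_at_left_filter; exact: continuous_horner].
- by move=> x _; rewrite derivE.
Qed.

Lemma sin_natmul_pi (R : realType) (m : nat) : sin (m%:R * pi) = 0 :> R.
Proof.
elim: m => [|m IHm]; first by rewrite mul0r sin0.
by rewrite -natr1 mulrDl mul1r sinDpi IHm oppr0.
Qed.

Lemma cos_natmul_pi (R : realType) (m : nat) : cos (m%:R * pi) = (-1) ^+ m :> R.
Proof.
elim: m => [|m IHm]; first by rewrite mul0r cos0.
by rewrite -natr1 mulrDl mul1r cosDpi IHm exprS mulN1r.
Qed.

(** The sum telescopes, since [2 * sin (t / 2) * cos (i * t)] equals [sin (i * t + t / 2) - sin (i *
    t - t / 2)]. Keeping the factor on the left avoids a division by zero. *)
Lemma sum_cos_natmul (R : realType) (t : R) (n : nat) :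
  2 * sin (t / 2) * (\sum_(i < n) cos (i%:R * t)) =
  sin (n%:R * t - t / 2) + sin (t / 2).
Proof.
elim: n => [|n IHn]; first by rewrite big_ord0 mulr0 mul0r sub0r sinN addNr.
rewrite big_ord_recr/= mulrDr IHn -[n.+1%:R]natr1.
have -> : (n%:R + 1) * t - t / 2 = n%:R * t + t / 2 by field.
by rewrite sinB sinD; ring.
Qed.

Lemma sum_cos_pi_fraction (R : realType) (m M : nat) : (0 < m < 2 * M)%N ->
  \sum_(i < M) cos (i%:R * (m%:R * pi / M%:R)) = (odd m)%:R :> R.
Proof.
move=> /andP[m0 mM].
have M0 : (0 : R) < M%:R by rewrite ltr0n; lia.
have pi0 := pi_gt0 R.
set t := m%:R * pi / M%:R.
(* The bounds on [m] say exactly that [t / 2] lies strictly between 0 and [pi], so this factor can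
   be cancelled. *)
have s0 : 0 < sin (t / 2).
  apply: sin_gt0_pi; rewrite /t; apply/andP; split.
    by rewrite !divr_gt0// mulr_gt0// ltr0n.
  rewrite ltr_pdivrMr// ltr_pdivrMr// mulrC -mulrA ltr_pM2l//.
  by rewrite -natrM ltr_nat; lia.
apply: (@mulfI _ (2 * sin (t / 2))); first by rewrite mulf_neq0// gt_eqF.
rewrite sum_cos_natmul.
(* The telescoped sum becomes [(1 - (-1) ^+ m) * sin (t / 2)]. *)
have -> : M%:R * t = m%:R * pi by rewrite /t; field; rewrite gt_eqF.
rewrite sinB sin_natmul_pi cos_natmul_pi -signr_odd.
by case: (odd m) => /=; rewrite ?expr0 ?expr1; ring.
Qed.

Lemma sum_sin_sin (R : realType) (k l N : nat) : (0 < k <= N)%N -> (0 < l <= N)%N ->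
  \sum_(i < N) sin ((i.+1 * k)%:R * pi / (N + 1)%:R)
             * sin ((i.+1 * l)%:R * pi / (N + 1)%:R) =
  (N + 1)%:R / 2 *+ (k == l) :> R.
Proof.
(* By symmetry, the frequency [k - l] can be a natural number. *)
wlog lk : k l / (l <= k)%N.
  move=> H kN lN; have [lk|/ltnW kl] := leqP l k; first exact: H.
  by rewrite eq_sym -H//; apply: eq_bigr => i _; rewrite mulrC.
move=> /andP[k0 kN] /andP[l0 lN].
pose F i : R := sin ((i * k)%:R * pi / (N + 1)%:R)
             * sin ((i * l)%:R * pi / (N + 1)%:R).
(* The added term at 0 vanishes; the cosine sums need all [N + 1] indices. *)
have -> : \sum_(i < N) F i.+1 = \sum_(i < N + 1) F i.
  by rewrite addn1 big_ord_recl/= {2}/F !mul0n !mul0r sin0 mul0r add0r.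
have FE i : F i = 2^-1 * (cos (i%:R * ((k - l)%N%:R * pi / (N + 1)%:R))
                        - cos (i%:R * ((k + l)%N%:R * pi / (N + 1)%:R))).
  rewrite natrB// (natrD _ k l).
  have -> : i%:R * ((k%:R - l%:R) * pi / (N + 1)%:R)
          = (i * k)%:R * pi / (N + 1)%:R - (i * l)%:R * pi / (N + 1)%:R :> R.
    by rewrite !natrM; ring.
  have -> : i%:R * ((k%:R + l%:R) * pi / (N + 1)%:R)
          = (i * k)%:R * pi / (N + 1)%:R + (i * l)%:R * pi / (N + 1)%:R :> R.
    by rewrite !natrM; ring.
  by rewrite cosB cosD /F; field.
rewrite (eq_bigr _ (fun (i : 'I_(N + 1)) _ => FE i)) -mulr_sumr sumrB.
rewrite (@sum_cos_pi_fraction _ (k + l)); last lia.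
(* If [k = l], frequency 0 contributes [N + 1] and the even frequency [k + l] contributes 0.
   Otherwise [k - l] and [k + l] have the same parity, and the two sums cancel. *)
have [->|kl] := eqVneq k l.
  rewrite subnn addnn odd_double subr0 mulr1n.
  rewrite (eq_bigr (fun=> 1)); last by move=> i _; rewrite !mul0r mulr0 cos0.
  by rewrite sumr_const card_ord mulrC.
rewrite sum_cos_pi_fraction; last lia.
by rewrite oddB// oddD subrr mulr0.
Qed.

(** The angles lie in [[0, pi]], where the cosine is strictly decreasing. *)
Lemma cheb_node_lt (R : realType) (N i : nat) : (i < N)%N ->
  cheb_node R N i.+1 < cheb_node R N i.
Proof.
move=> iN; have pi0 := pi_gt0 R.
have M0 : (0 : R) < (2 * (N + 1))%:R by rewrite ltr0n; lia.
have nodeI j : (j <= N)%N ->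
    (2 * j + 1)%:R * pi / (2 * (N + 1))%:R \in `[0, (pi : R)].
  move=> jN; rewrite in_itv/= divr_ge0 ?mulr_ge0 ?pi_ge0//=.
  by rewrite ler_pdivrMr// mulrC ler_pM2l// ler_nat; lia.
rewrite /cheb_node ltr_cos ?nodeI//; last exact: ltnW.
by rewrite ltr_pM2r ?invr_gt0// ltr_pM2r// ltr_nat; lia.
Qed.

Lemma cheb_D_factor (R : realType) (T : nat -> {poly R})
    (hT : forall k : nat, is_chebyshev k (T k)) (N : nat) :
  cheb_D T N = cheb_S R N *m cheb_Sigma R N.
Proof.
apply/matrixP => i k; rewrite mul_mx_diag !mxE /cheb_segment/=.
rewrite Rintegral_deriv_poly ?cheb_node_lt// /cheb_node !(hT _).2.
(* The endpoint angles, multiplied by [k.+1], are [u - v] and [u + v], and [cos (u - v) - cos (u +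
   v) = 2 * sin u * sin v]. *)
set u := (i.+1 * k.+1)%:R * pi / (N + 1)%:R.
set v := k.+1%:R * pi / (2 * (N + 1))%:R.
have -> : k.+1%:R * ((2 * i + 1)%:R * pi / (2 * (N + 1))%:R) = u - v.
  by rewrite /u /v [(_ + 1)%:R]natrD !natrM -[i.+1%:R]natr1; field.
have -> : k.+1%:R * ((2 * i.+1 + 1)%:R * pi / (2 * (N + 1))%:R) = u + v.
  by rewrite /u /v [(_ + 1)%:R]natrD !natrM -[i.+1%:R]natr1; field.
by rewrite cosB cosD; ring.
Qed.

Lemma cheb_S_gram (R : realType) (N : nat) :
  (cheb_S R N)^T *m cheb_S R N = ((N + 1)%:R / 2)%:M.
Proof.
apply/matrixP => k l; rewrite !mxE.
under eq_bigr do rewrite !mxE.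
by rewrite sum_sin_sin//= ltn_ord.
Qed.

Theorem theorem4 (R : realType) (T : nat -> {poly R})
    (hT : forall k : nat, is_chebyshev k (T k))
    (N : nat) (hN : (1 <= N)%N) :
  cheb_D T N = cheb_S R N *m cheb_Sigma R N /\
  (cheb_D T N)^T *m cheb_D T N = ((N + 1)%:R / 2) *: (cheb_Sigma R N ^+ 2).
Proof.
split; first exact: cheb_D_factor.
rewrite cheb_D_factor// trmx_mul tr_diag_mx mulmxA -(mulmxA (diag_mx _)).
by rewrite cheb_S_gram mul_mx_scalar -scalemxAl expr2.
Qed.
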